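(* Let $\mathsf{PAs}^{\rightarrow}$ be the graded vector space (over a field $\mathbb{K}$ of characteristic zero) such that for each $n \geq 1$, $\mathsf{PAs}^{\rightarrow}(n)$ has basis $\{\mathsf{E}_u : u \in \mathfrak{P}_n\}$, where $\mathfrak{P}_n$ is the set of packed words of length $n$. For $u \in \mathfrak{P}_n$ with maximal letter $r$, $i \in [n]$, and $v \in \mathfrak{P}_m$ with maximal letter $s$, define $$\mathsf{E}_u \circ_i \mathsf{E}_v := \mathsf{E}_{\mathrm{inc}_{s-1,\,u(i)}(u(1,i-1))\ .\ \mathrm{inc}_{u(i)-1,\,0}(v)\ .\ \mathrm{inc}_{s-1,\,u(i)-1}(u(i+1,n))},$$ extended bilinearly, which is an element of $\mathsf{PAs}^{\rightarrow}(n+m-1)$. Then $\mathsf{PAs}^{\rightarrow}$ endowed with these partial compositions $\circ_i$ is a nonsymmetric unital operad: the partial compositions satisfy the sequential associativity axiom $(x \circ_i y)\circ_{i+j-1} z = x \circ_i (y \circ_j z)$ and the parallel associativity axiom $(x \circ_i y) \circ_{j+m-1} z = (x \circ_j z) \circ_i y$ for $i<j$ (with $y$ of arity $m$), and $\mathsf{E}_1$ is a two-sided unit ($\mathsf{E}_1 \circ_1 x = x$ and $x \circ_i \mathsf{E}_1 = x$).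
   Context: $\mathbb{P} = \{1,2,3,\dots\}$, $[i] = \{1,\dots,i\}$. For a word $w$ over $\mathbb{P}$, $w(i)$ is its $i$-th letter, $w(i,j) = w(i)\cdots w(j)$ (the empty word if $j<i$), and $.$ denotes concatenation. A packed word is a word $w$ over $\mathbb{P}$ whose set of letters is $[k]$ for some $k \geq 0$. For $\alpha,\beta \in \mathbb{N}$ and a word $u$ over $\mathbb{P}$, $\mathrm{inc}_{\alpha,\beta}(u)$ is the word obtained from $u$ by adding $\alpha$ to every letter of $u$ that is strictly greater than $\beta$ (other letters unchanged). For example, with $u = 2311223$, $v=221$: $\mathsf{E}_u \circ_4 \mathsf{E}_v = \mathsf{E}_{241133234}$. *)

(* Defs.v *)
From HB Require Import structures.
From mathcomp Require Import all_boot all_order all_algebra.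
From mathcomp Require Import zify finmap.
From mathcomp.multinomials Require Import monalg.

Set Implicit Arguments.
Unset Strict Implicit.
Unset Printing Implicit Defensive.

Import GRing.Theory.

(** * Packed words *)

Definition max_letter (w : seq nat) : nat := \max_(a <- w) a.

(* If the set of letters of [w] is [k], then k is the maximal letter of w (or
   0 when w is empty), hence this boolean form; see [packedP]. *)
Definition packed (w : seq nat) : bool :=
  (0 \notin w) && all [in w] (iota 1 (max_letter w)).

Lemma packedP (w : seq nat) : reflect (exists k, w =i iota 1 k) (packed w).
Proof.
have max_ub a : a \in w -> a <= max_letter w.
  by move=> aw; rewrite /max_letter; apply: leq_bigmax_seq.
apply: (iffP andP) => [[w0 /allP wT]|[k wk]].
  exists (max_letter w) => a; apply/idP/idP => [aw|/wT //].
  rewrite mem_iota add1n ltnS max_ub // andbT lt0n.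
  by apply: contraNneq w0 => <-.
split; first by rewrite wk mem_iota.
apply/allP => a; rewrite mem_iota add1n ltnS => a_bd;
rewrite /= wk mem_iota add1n ltnS.
case/andP: a_bd => -> /= /leq_trans; apply; rewrite /max_letter.
by apply/bigmax_leqP_seq => b; rewrite wk mem_iota add1n ltnS => /andP[].
Qed.

Lemma packed_mem (w : seq nat) (a : nat) :
  packed w -> (a \in w) = (0 < a <= max_letter w).
Proof.
case/andP=> w0 /allP wT; apply/idP/idP => [aw|aw]; last first.
  by apply: wT; rewrite mem_iota add1n ltnS.
rewrite lt0n /max_letter (leq_bigmax_seq _ aw) // andbT.
by apply: contraNneq w0 => <-.
Qed.

Record packed_word (n : nat) := PackedWord {
  pw_tuple :> n.-tuple nat;
  pw_packed : packed pw_tuple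
}.

HB.instance Definition _ n := [isSub for @pw_tuple n].
HB.instance Definition _ n := [Choice of packed_word n by <:].

Definition inc (alpha beta : nat) (u : seq nat) : seq nat :=
  [seq if beta < a then a + alpha else a | a <- u].

(* Positions are counted from 0: i stands for the position i + 1 of the
   informal definition, so that u(i) is [nth 0 u i], u(1, i - 1) is [take i u]
   and u(i + 1, n) is [drop i.+1 u]. *)
Definition word_comp (u : seq nat) (i : nat) (v : seq nat) : seq nat :=
  let a := nth 0 u i in
  let s := max_letter v in
  inc s.-1 a (take i u) ++ inc a.-1 0 v ++ inc s.-1 a.-1 (drop i.+1 u).

(* E_2311223 o_5 E_221 = E_241133234, the fifth letter of 2311223 being 2. *)
Example word_comp_ex :
  word_comp [:: 2; 3; 1; 1; 2; 2; 3] 4 [:: 2; 2; 1]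
  = [:: 2; 4; 1; 1; 3; 3; 2; 3; 4].
Proof. by rewrite /word_comp /max_letter unlock. Qed.

Lemma size_word_comp (u v : seq nat) (i n m : nat) :
  size u = n.+1 -> size v = m.+1 -> i < n.+1 ->
  size (word_comp u i v) = (n + m).+1.
Proof.
move=> su sv lti; rewrite /word_comp !size_cat !size_map size_drop sv.
by rewrite size_takel su; lia.
Qed.

Lemma packed_word_comp (u v : seq nat) (i : nat) :
  packed u -> packed v -> i < size u -> 0 < size v -> packed (word_comp u i v).
Proof.
move=> pu pv lti v_gt0; rewrite /word_comp.
set a := nth 0 u i; set s := max_letter v.
have au : a \in u by apply: mem_nth.
have defu x : (x \in u) = [|| x \in take i u, x == a | x \in drop i.+1 u].
  by rewrite -{1}(cat_take_drop i u) (drop_nth 0 lti) mem_cat inE.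
have memu x := packed_mem x pu; have memv x := packed_mem x pv.
have s_gt0 : 0 < s.
  case: v v_gt0 {pv} @s memv => // b v _ s memv.
  by have := memv b; rewrite mem_head -/s; lia.
have := memu a; rewrite au => /esym/andP[a_gt0 a_le].
apply/packedP; exists ((max_letter u + s).-1) => x.
rewrite mem_iota !mem_cat; apply/idP/idP.
  case/or3P=> /mapP[y yw ->].
  - have := memu y; rewrite defu yw /=; case: ifP; lia.
  - have := memv y; rewrite yw -/s; case: ifP; lia.
  - have := memu y; rewrite defu yw !orbT; case: ifP; lia.
move=> x_bd; have [x_lta|a_lex] := ltnP x a.
  have : x \in u by rewrite memu; lia.
  rewrite defu => /or3P[xl|/eqP|xr]; last 2 first.
  - lia.
  - by apply/or3P/Or33/mapP; exists x => //; case: ifP; lia.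
  by apply/or3P/Or31/mapP; exists x => //; case: ifP; lia.
have [x_lt|x_ge] := ltnP x (a + s).
  apply/or3P/Or32/mapP; exists (x - a.-1); first by rewrite memv -/s; lia.
  by case: ifP; lia.
have : x - s.-1 \in u by rewrite memu; lia.
rewrite defu => /or3P[xl|/eqP|xr].
- by apply/or3P/Or31/mapP; exists (x - s.-1) => //; case: ifP; lia.
- lia.
- by apply/or3P/Or33/mapP; exists (x - s.-1) => //; case: ifP; lia.
Qed.

Section PackedComp.
Variables (n m : nat) (i : 'I_n.+1).
Variables (u : packed_word n.+1) (v : packed_word m.+1).

Fact pw_comp_size : size (word_comp u i v) == (n + m).+1.
Proof. by apply/eqP/size_word_comp; rewrite ?size_tuple. Qed.

Fact pw_comp_packed : packed (Tuple pw_comp_size).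
Proof. by apply: packed_word_comp; rewrite ?pw_packed ?size_tuple. Qed.

Definition pw_comp : packed_word (n + m).+1 := PackedWord pw_comp_packed.

End PackedComp.

Fact packed1 : packed [tuple 1].
Proof. by rewrite /packed /max_letter unlock. Qed.

Definition pw1 : packed_word 1 := PackedWord packed1.

(** * Nonsymmetric unital operads *)

Local Open Scope ring_scope.

(* V k is the component of arity k, and only positive arities are considered:
   for x of arity n.+1 and y of arity m.+1, the arity of x o_i y is
   n.+1 + m.+1 - 1, that is (n + m).+1.  Input positions are counted from 0, so
   that the indices i + j - 1 and j + arity(y) - 1 of the two associativity
   axioms for positions counted from 1 become i + j and j + m here.  All the
   occurrences of [inord] are within bounds.  The transports [ecast] are along
   equalities of arities. *)
Record ns_operad (K : fieldType) (V : nat -> lmodType K)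
    (circ : forall n m : nat, 'I_n.+1 -> V n.+1 -> V m.+1 -> V (n + m).+1)
    (one : V 1) : Prop := NsOperad {
  ns_linearl : forall n m (i : 'I_n.+1) (y : V m.+1) (c : K) (x x' : V n.+1),
    circ n m i (c *: x + x') y = c *: circ n m i x y + circ n m i x' y;
  ns_linearr : forall n m (i : 'I_n.+1) (x : V n.+1) (c : K) (y y' : V m.+1),
    circ n m i x (c *: y + y') = c *: circ n m i x y + circ n m i x y';
  ns_sequential : forall n m p (i : 'I_n.+1) (j : 'I_m.+1)
      (x : V n.+1) (y : V m.+1) (z : V p.+1),
    circ (n + m)%N p (inord (i + j)) (circ n m i x y) z
    = ecast k (V k.+1) (addnA n m p) (circ n (m + p)%N i x (circ m p j y z));
  ns_parallel : forall n m p (i j : 'I_n.+1)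
      (x : V n.+1) (y : V m.+1) (z : V p.+1), (i < j)%N ->
    circ (n + m)%N p (inord (j + m)) (circ n m i x y) z
    = ecast k (V k.+1) (addnAC n p m)
        (circ (n + p)%N m (inord i) (circ n p j x z) y);
  ns_unitl : forall n (x : V n.+1), circ 0%N n ord0 one x = x;
  ns_unitr : forall n (i : 'I_n.+1) (x : V n.+1),
    ecast k (V k.+1) (addn0 n) (circ n 0%N i x one) = x
}.

(** * The operad of packed words *)

(* The free K-module on the packed words of length n.  The component of
   index 0 plays no role in [ns_operad]. *)
Definition PAs (K : fieldType) (n : nat) : lmodType K := {malg K[packed_word n]}.

Definition PAs_E (K : fieldType) (n : nat) (u : packed_word n) : PAs K n :=
  << u >>.

Definition PAs_comp (K : fieldType) (n m : nat) (i : 'I_n.+1)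
    (x : PAs K n.+1) (y : PAs K m.+1) : PAs K (n + m).+1 :=
  \sum_(u <- msupp x) \sum_(v <- msupp y)
    (x@_u * y@_v) *: PAs_E K (pw_comp i u v).

Lemma PAs_comp_E (K : fieldType) (n m : nat) (i : 'I_n.+1)
    (u : packed_word n.+1) (v : packed_word m.+1) :
  PAs_comp i (PAs_E K u) (PAs_E K v) = PAs_E K (pw_comp i u v).
Proof.
rewrite /PAs_comp /PAs_E !msuppU oner_eq0 !big_seq_fset1 !mcoeffUU.
by rewrite mulr1 scale1r.
Qed.

(* Main.v *)
(** By trilinearity the operad axioms reduce to identities between words.  In
    each of them both sides decompose into the same five blocks of letters of
    the three words, shifted by two successive increments, so the identities
    can be checked letter by letter.  Besides the bounds [0 < x <= max] on the
    letters of a packed word, the sequential axiom uses that the maximal letter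
    of [v o_j w] is [max v + max w - 1]; in the parallel axiom the asymmetry of
    the thresholds [u(i)] and [u(i) - 1] is what separates two equal letters. *)

Require Import Defs.
From mathcomp Require Import all_boot all_order all_algebra.
From HB Require Import structures.
From mathcomp Require Import zify finmap.
From mathcomp.multinomials Require Import monalg.

Set Implicit Arguments.
Unset Strict Implicit.
Unset Printing Implicit Defensive.

Import GRing.Theory.

(** * Letters of packed words, increments and block decompositions *)

Lemma letter_le_max (w : seq nat) (x : nat) : x \in w -> x <= max_letter w.
Proof. by move=> xw; rewrite /max_letter; apply: leq_bigmax_seq. Qed.

Lemma packed_letter_gt0 (w : seq nat) (x : nat) : packed w -> x \in w -> 0 < x.
Proof. by move=> pw; rewrite (packed_mem x pw) => /andP[]. Qed.

Lemma packed_max_mem (w : seq nat) :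
  packed w -> 0 < size w -> max_letter w \in w.
Proof.
case: w => // a w pw _; rewrite (packed_mem _ pw) leqnn andbT.
exact: leq_trans (packed_letter_gt0 pw (mem_head a w))
                 (letter_le_max (mem_head a w)).
Qed.

Lemma max_letter_eq (w : seq nat) (k : nat) :
  k \in w -> (forall x, x \in w -> x <= k) -> max_letter w = k.
Proof.
move=> kw kmax; apply/eqP; rewrite eqn_leq (letter_le_max kw) andbT.
by apply/bigmax_leqP_seq => x /kmax.
Qed.

Lemma inc_cat (alpha beta : nat) (u v : seq nat) :
  inc alpha beta (u ++ v) = inc alpha beta u ++ inc alpha beta v.
Proof. exact: map_cat. Qed.

Lemma inc0 (beta : nat) (u : seq nat) : inc 0 beta u = u.
Proof.
by rewrite /inc -[RHS]map_id; apply: eq_map => x; rewrite addn0 if_same.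
Qed.

(** Increments act letterwise, so comparing two double increments on a block is a case analysis on
    thresholds for each letter. A single increment fits this form once padded with [inc 0 0]. *)
Lemma eq_inc2 (a b c d a' b' c' d' : nat) (w : seq nat) :
  (forall x, x \in w ->
    (let y := if b < x then x + a else x in if d < y then y + c else y)
    = (let y := if b' < x then x + a' else x in if d' < y then y + c' else y)) ->
  inc c d (inc a b w) = inc c' d' (inc a' b' w).
Proof. by move=> e; rewrite /inc -!map_comp; apply/eq_in_map. Qed.

(** Cutting the outer word at its pivot letter [a] removes [nth], [take] and [drop], which makes
    iterated compositions computable block by block. *)
Lemma word_comp_cat (u1 u2 v : seq nat) (a i : nat) : i = size u1 ->
  word_comp (u1 ++ a :: u2) i v
  = inc (max_letter v).-1 a u1 ++ inc a.-1 0 v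
    ++ inc (max_letter v).-1 a.-1 u2.
Proof.
move=> ->; rewrite /word_comp nth_cat ltnn subnn take_size_cat //.
by rewrite drop_cat ltnNge leqnSn /= subSnn drop1.
Qed.

Lemma split_at (u : seq nat) (i : nat) : i < size u ->
  exists u1 a u2, u = u1 ++ a :: u2 /\ i = size u1.
Proof.
move=> lti; exists (take i u), (nth 0 u i), (drop i.+1 u).
by rewrite -drop_nth // cat_take_drop size_takel // ltnW.
Qed.

(** This maximum fixes how far [v o_j w] shifts the letters of an outer word. With [s] and [t] the
    maxima of [v] and [w], letters of [v] gain at most [t - 1], and letters of [w] gain
    [b - 1 <= s - 1], where [b] is the replaced letter. *)
Lemma max_word_comp (v w : seq nat) (j : nat) :
  packed v -> packed w -> j < size v -> 0 < size w ->
  max_letter (word_comp v j w) = (max_letter v + max_letter w).-1.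
Proof.
move=> pv pw ltj w_gt0.
have smem := packed_max_mem pv (leq_ltn_trans (leq0n j) ltj).
have tmem := packed_max_mem pw w_gt0; have t_gt0 := packed_letter_gt0 pw tmem.
have v_le x := @letter_le_max v x; have w_le x := @letter_le_max w x.
have v_gt x := @packed_letter_gt0 v x pv.
have [v1 [b [v2 [def_v def_j]]]] := split_at ltj.
move: smem v_le v_gt; set s := max_letter v.
set t := max_letter w in tmem t_gt0 w_le *.
rewrite def_v (word_comp_cat _ _ _ def_j) -/t => smem v_le v_gt.
have b_le : 0 < b <= s by rewrite v_gt ?v_le // mem_cat mem_head orbT.
apply: max_letter_eq => [|x]; rewrite !mem_cat.
  (* If [b] is the maximum [s], the bound is attained by the letter [t] of [w], raised by [s - 1].
     Otherwise [s] occurs elsewhere in [v], above both thresholds, and is raised by [t - 1]. *)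
  move: smem; rewrite mem_cat inE; have [<- _|ne_sb] := eqVneq s b.
    by apply/or3P/Or32/mapP; exists t => //; rewrite t_gt0; lia.
  case/orP=> smem; apply/or3P; [apply: Or31|apply: Or33];
    by apply/mapP; exists s => //; case: ifP; lia.
case/or3P=> /mapP[y yw ->].
- by have := v_le y; rewrite mem_cat yw; case: ifP; lia.
- by have := w_le y yw; case: ifP; lia.
- by have := v_le y; rewrite mem_cat inE yw !orbT; case: ifP; lia.
Qed.

(** * The operad axioms at the level of words *)

Lemma word_comp_sequential (u v w : seq nat) (i j : nat) :
  packed u -> packed v -> packed w ->
  i < size u -> j < size v -> 0 < size w ->
  word_comp (word_comp u i v) (i + j) w = word_comp u i (word_comp v j w).
Proof.
move=> pu pv pw lti ltj w_gt0.
have max_vw := max_word_comp pv pw ltj w_gt0.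
have t_gt0 := packed_letter_gt0 pw (packed_max_mem pw w_gt0).
have v_le x := @letter_le_max v x.
have u_gt x := @packed_letter_gt0 u x pu.
have v_gt x := @packed_letter_gt0 v x pv.
have w_gt x := @packed_letter_gt0 w x pw.
have [u1 [a [u2 [def_u def_i]]]] := split_at lti.
have [v1 [b [v2 [def_v def_j]]]] := split_at ltj.
rewrite def_u (word_comp_cat _ _ _ def_i) (word_comp_cat _ _ _ def_i).
rewrite max_vw {max_vw pu pv lti ltj}.
move: u_gt v_gt v_le t_gt0; set s := max_letter v; set t := max_letter w.
rewrite def_u def_v => u_gt v_gt v_le t_gt0.
have a_gt0 : 0 < a by rewrite u_gt // mem_cat mem_head orbT.
have b_le : 0 < b <= s by rewrite v_gt ?v_le // mem_cat mem_head orbT.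
rewrite (word_comp_cat _ _ _ def_j) -/t !inc_cat /=.
(* Being positive, [b] becomes [b + a.-1] in [u o_i v]; the concatenations are regrouped around this
   letter, the pivot of the second composition. *)
case/andP: b_le => b_gt0 b_le; rewrite b_gt0 -!catA !catA -(catA _ (_ :: _)) /=.
rewrite word_comp_cat ?size_cat ?size_map; last by rewrite def_i def_j.
rewrite -/t !inc_cat !catA -!catA.
(* The blocks come from [u1], [v1], [w], [v2], [u2]. On the outer two, [0 < b <= s] ensures that
   exactly the letters raised by [s - 1] pass the second threshold, so the shifts add up to
   [s + t - 2]. *)
congr (_ ++ (_ ++ (_ ++ (_ ++ _)))).
- rewrite -[RHS](inc0 0); apply: eq_inc2 => x _ /=.
  by do ! case: ifP; lia.
- apply: eq_inc2 => x xv /=.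
  have := v_le x; have := v_gt x; rewrite mem_cat xv => /(_ isT) ? /(_ isT) ?.
  by do ! case: ifP; lia.
- rewrite -[LHS](inc0 0); apply: eq_inc2 => x /w_gt /= ?.
  by do ! case: ifP; lia.
- apply: eq_inc2 => x xv /=.
  have := v_le x; have := v_gt x; rewrite mem_cat inE xv !orbT.
  move=> /(_ isT) ? /(_ isT) ?; by do ! case: ifP; lia.
- rewrite -[RHS](inc0 0); apply: eq_inc2 => x _ /=.
  by do ! case: ifP; lia.
Qed.

Lemma word_comp_parallel (u v w : seq nat) (i j m : nat) :
  packed u -> packed v -> packed w ->
  i < j -> j < size u -> size v = m.+1 -> 0 < size w ->
  word_comp (word_comp u i v) (j + m) w = word_comp (word_comp u j w) i v.
Proof.
move=> pu pv pw ltij ltj sv w_gt0.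
have s_gt0 : 0 < max_letter v.
  by apply: (packed_letter_gt0 pv); apply: packed_max_mem; rewrite ?sv.
have t_gt0 := packed_letter_gt0 pw (packed_max_mem pw w_gt0).
have v_le x := @letter_le_max v x; have w_le x := @letter_le_max w x.
have u_gt x := @packed_letter_gt0 u x pu.
have v_gt x := @packed_letter_gt0 v x pv.
have w_gt x := @packed_letter_gt0 w x pw.
have [u1 [a [u' [def_u def_i]]]] := split_at (ltn_trans ltij ltj).
(* As [i < j], the second pivot lies in the tail after [a], at index [j - i.+1] of it. *)
have ltj' : j - i.+1 < size u'.
  by move: ltj; rewrite def_u size_cat /= -def_i; lia.
have [u2 [b [u3 [def_u' def_j]]]] := split_at ltj'.
move: u_gt s_gt0 t_gt0 v_le w_le; set s := max_letter v; set t := max_letter w.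
rewrite def_u def_u' => u_gt s_gt0 t_gt0 v_le w_le.
have a_gt0 : 0 < a by rewrite u_gt // mem_cat mem_head orbT.
have b_gt0 : 0 < b by rewrite u_gt // !(mem_cat, inE) eqxx !orbT.
rewrite (word_comp_cat _ _ _ def_i) -/s.
have -> : u1 ++ a :: u2 ++ b :: u3 = (u1 ++ a :: u2) ++ b :: u3.
  by rewrite -catA.
rewrite (@word_comp_cat (u1 ++ a :: u2)); last first.
  by rewrite size_cat /= -def_i -def_j; lia.
rewrite -/t !inc_cat /= !catA word_comp_cat; last first.
  by rewrite !size_cat !size_map sv -def_i -def_j; lia.
rewrite -!catA /= (word_comp_cat _ v); last by rewrite size_map.
rewrite -/s -/t !inc_cat -!catA.
(* The blocks come from [u1], [v], [u2], [w], [u3]. If [a <= b], equality included, the copy of [w]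
   is raised by [s - 1] and that of [v] stays; if [b < a], the copy of [v] is raised by [t - 1] and
   that of [w] stays. *)
congr (_ ++ (_ ++ (_ ++ (_ ++ _)))).
- by apply: eq_inc2 => x _ /=; do ! case: ifP; lia.
- rewrite -[RHS](inc0 0); apply: eq_inc2 => x xv /=.
  by have := v_le x xv; have := v_gt x xv; do ! case: ifP; lia.
- by apply: eq_inc2 => x _ /=; do ! case: ifP; lia.
- rewrite -[LHS](inc0 0); apply: eq_inc2 => x xw /=.
  by have := w_le x xw; have := w_gt x xw; do ! case: ifP; lia.
- by apply: eq_inc2 => x _ /=; do ! case: ifP; lia.
Qed.

Lemma word_comp_unitl (v : seq nat) : word_comp [:: 1] 0 v = v.
Proof. by rewrite /word_comp /= inc0 cats0. Qed.

(** The inserted word has maximum 1, so the other letters shift by 0, and the pivot is replaced by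
    [1 + a.-1], which is [a] by positivity. *)
Lemma word_comp_unitr (u : seq nat) (i : nat) :
  packed u -> i < size u -> word_comp u i [:: 1] = u.
Proof.
move=> pu lti; have [u1 [a [u2 [def_u def_i]]]] := split_at lti.
have a_gt0 : 0 < a.
  by apply: (packed_letter_gt0 pu); rewrite def_u mem_cat mem_head orbT.
rewrite {1}def_u (word_comp_cat _ _ _ def_i) /max_letter big_seq1 /= !inc0.
by rewrite add1n prednK.
Qed.

Local Open Scope ring_scope.

(** * Linear extension from the basis of a free module *)

Section MalgLinear.
Variables (K : fieldType) (T : choiceType) (W : lmodType K).
Implicit Types (x : {malg K[T]}) (h : T -> W).

Lemma malg_sumEw {h x} {d : {fset T}} : (msupp x `<=` d)%fset ->
  \sum_(u <- msupp x) x@_u *: h u = \sum_(u <- d) x@_u *: h u.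
Proof.
move=> sxd; rewrite (big_fset_incl _ sxd) // => u _ /mcoeff_outdom ->.
exact: scale0r.
Qed.

Lemma malg_sum_linear h :
  linear (fun x : {malg K[T]} => \sum_(u <- msupp x) x@_u *: h u).
Proof.
(* Cancellation can shrink the support of [c *: x + y], so all three sums are taken over the union
   [d]. *)
move=> c x y; pose d := (msupp x `|` msupp y)%fset.
have sx : (msupp x `<=` d)%fset by apply: fsubsetUl.
have sy : (msupp y `<=` d)%fset by apply: fsubsetUr.
have sxy : (msupp (c *: x + y) `<=` d)%fset.
  by apply: (fsubset_trans (msuppD_le _ _)); apply: fsetSU; apply: msuppZ_le.
rewrite (malg_sumEw sx) (malg_sumEw sy) (malg_sumEw sxy) scaler_sumr.
rewrite -big_split /=; apply: eq_bigr => u _.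
by rewrite mcoeffD mcoeffZ scalerDl scalerA.
Qed.

Lemma malg_linear_ext (f g : {malg K[T]} -> W) : linear f -> linear g ->
  (forall u, f << u >> = g << u >>) -> f =1 g.
Proof.
move=> lf lg efg x.
pose F : {linear _ -> _} := HB.pack f (GRing.isLinear.Build _ _ _ _ f lf).
pose G : {linear _ -> _} := HB.pack g (GRing.isLinear.Build _ _ _ _ g lg).
rewrite -[f]/(F : _ -> _) -[g]/(G : _ -> _) (monalgE x) !linear_sum.
apply: eq_bigr => u _.
have -> : << x@_u *g u >> = x@_u *: << u >> :> {malg K[T]}.
  by apply/malgP => v; rewrite mcoeffZ !mcoeffU mulrnAr mulr1.
by rewrite !linearZ /= efg.
Qed.

End MalgLinear.

(** * Bilinearity of the compositions and transport along arities *)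

Section PAsOperad.
Variable K : fieldType.

(** This nesting of the double sum has the shape required by [malg_sum_linear] for the left
    argument; [PAs_compEr] serves the right one. *)
Lemma PAs_compEl (n m : nat) (i : 'I_n.+1) (x : PAs K n.+1) (y : PAs K m.+1) :
  PAs_comp i x y = \sum_(u <- msupp x) x@_u *:
    (\sum_(v <- msupp y) y@_v *: PAs_E K (pw_comp i u v)).
Proof.
apply: eq_bigr => u _; rewrite scaler_sumr.
by apply: eq_bigr => v _; rewrite scalerA.
Qed.

Lemma PAs_compEr (n m : nat) (i : 'I_n.+1) (x : PAs K n.+1) (y : PAs K m.+1) :
  PAs_comp i x y = \sum_(v <- msupp y) y@_v *:
    (\sum_(u <- msupp x) x@_u *: PAs_E K (pw_comp i u v)).
Proof.
rewrite /PAs_comp exchange_big; apply: eq_bigr => v _; rewrite scaler_sumr.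
by apply: eq_bigr => u _; rewrite scalerA mulrC.
Qed.

Lemma PAs_comp_linearl (n m : nat) (i : 'I_n.+1) (y : PAs K m.+1) :
  linear (fun x : PAs K n.+1 => PAs_comp i x y).
Proof. by move=> c x x'; rewrite !PAs_compEl; exact: malg_sum_linear. Qed.

Lemma PAs_comp_linearr (n m : nat) (i : 'I_n.+1) (x : PAs K n.+1) :
  linear (fun y : PAs K m.+1 => PAs_comp i x y).
Proof. by move=> c y y'; rewrite !PAs_compEr; exact: malg_sum_linear. Qed.

Lemma PAs_ecast_linear (p q : nat) (e : p = q) (c : K) (x y : PAs K p.+1) :
  ecast k (PAs K k.+1) e (c *: x + y)
  = c *: ecast k (PAs K k.+1) e x + ecast k (PAs K k.+1) e y.
Proof. by case: q / e. Qed.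

(** Destructing [e] removes the transport, and injectivity of the two subtype projections leaves an
    identity between bare words. *)
Lemma PAs_ecast_E (p q : nat) (e : p = q) (u : packed_word p.+1)
    (v : packed_word q.+1) :
  u = v :> seq nat -> PAs_E K v = ecast k (PAs K k.+1) e (PAs_E K u).
Proof.
by case: q / e v => v euv; congr PAs_E; apply/val_inj/val_inj.
Qed.

Lemma PAs_trilinear_ext (n m p q : nat)
    (f g : PAs K n -> PAs K m -> PAs K p -> PAs K q) :
  (forall y z, linear (fun x => f x y z)) ->
  (forall y z, linear (fun x => g x y z)) ->
  (forall x z, linear (fun y => f x y z)) ->
  (forall x z, linear (fun y => g x y z)) ->
  (forall x y, linear (f x y)) -> (forall x y, linear (g x y)) ->
  (forall u v w, f (PAs_E K u) (PAs_E K v) (PAs_E K w)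
                 = g (PAs_E K u) (PAs_E K v) (PAs_E K w)) ->
  forall x y z, f x y z = g x y z.
Proof.
move=> f1 g1 f2 g2 f3 g3 efg x y z.
apply: (malg_linear_ext (f1 y z) (g1 y z)) => u.
apply: (malg_linear_ext (f2 _ z) (g2 _ z)) => v.
by apply: (malg_linear_ext (f3 _ _) (g3 _ _)) => w; apply: efg.
Qed.

End PAsOperad.

Theorem theorem2p1 (K : fieldType) (charK0 : [pchar K]%R =i pred0) :
  ns_operad (@PAs_comp K) (PAs_E K pw1).
Proof.
have linl n m i y c x x' := @PAs_comp_linearl K n m i y c x x'.
have linr n m i x c y y' := @PAs_comp_linearr K n m i x c y y'.
split.
- by move=> *; apply: linl.
- by move=> *; apply: linr.
- move=> n m p i j.
  apply: PAs_trilinear_ext => [y z c x x'|y z c x x'|x z c y y'|x z c y y'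
                              |x y c z z'|x y c z z'|u v w] /=.
  + by rewrite !linl.
  + by rewrite !linl PAs_ecast_linear.
  + by rewrite linr linl.
  + by rewrite linl linr PAs_ecast_linear.
  + by rewrite linr.
  + by rewrite !linr PAs_ecast_linear.
  rewrite !PAs_comp_E; apply: PAs_ecast_E => /=.
  rewrite inordK; last by have := ltn_ord i; have := ltn_ord j; lia.
  by rewrite word_comp_sequential ?pw_packed ?size_tuple.
- move=> n m p i j x y z ltij; move: x y z.
  apply: PAs_trilinear_ext => [y z c x x'|y z c x x'|x z c y y'|x z c y y'
                              |x y c z z'|x y c z z'|u v w] /=.
  + by rewrite !linl.
  + by rewrite !linl PAs_ecast_linear.
  + by rewrite linr linl.
  + by rewrite linr PAs_ecast_linear.
  + by rewrite linr.
  + by rewrite linr linl PAs_ecast_linear.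
  rewrite !PAs_comp_E; apply: PAs_ecast_E => /=.
  have [lti ltj] := (ltn_ord i, ltn_ord j).
  rewrite !inordK; [|lia..].
  by symmetry; apply: word_comp_parallel; rewrite ?pw_packed ?size_tuple.
(* Here [0 + n] reduces to [n], so no transport occurs, whereas the right unit law needs one along
   [addn0]. *)
- move=> n; apply: malg_linear_ext => // [c x x'|u]; first exact: linr.
  rewrite [LHS]PAs_comp_E; congr PAs_E; apply/val_inj/val_inj => /=.
  exact: word_comp_unitl.
- move=> n i; apply: malg_linear_ext => // [c x x'|u].
    by rewrite linl PAs_ecast_linear.
  rewrite [PAs_comp _ _ _]PAs_comp_E; symmetry; apply: PAs_ecast_E => /=.
  by rewrite word_comp_unitr ?pw_packed ?size_tuple.
Qed.
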